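(* Let $0\le s\le n-3$. Then the graph $K_{n-s}^n(l_1,l_2,\ldots,l_{n-s})$ with $|l_i-l_j|\le 1$ for all $i,j\in\{1,2,\ldots,n-s\}$ has the minimum Wiener index over $\mathfrak{C}_{n,s}$, the set of all connected graphs on $n$ vertices with exactly $s$ cut vertices.
   Context: All graphs are finite, simple, connected and undirected. The Wiener index of a connected graph $G$ is $W(G)=\sum_{\{u,v\}\subseteq V(G)}d_G(u,v)$, where the sum is over unordered pairs of vertices and $d_G$ is the shortest-path distance. A vertex $v$ of $G$ is a cut vertex if $G\setminus v$ is disconnected. $\mathfrak{C}_{n,s}$ is the set of all connected graphs on $n$ vertices with exactly $s$ cut vertices. For $2\le m\le n$, let $v_1,\ldots,v_m$ be the vertices of the complete graph $K_m$, and let $l_1,\ldots,l_m$ be positive integers with $l_1+\cdots+l_m=n$. The graph $K_m^n(l_1,\ldots,l_m)$ on $n$ vertices is obtained by identifying, for each $i=1,\ldots,m$, an end vertex of the path $P_{l_i}$ on $l_i$ vertices with the vertex $v_i$ (when $l_i=1$ nothing is attached at $v_i$). *)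

(* Defs.v *)
From mathcomp Require Import all_boot.

Set Implicit Arguments.
Unset Strict Implicit.
Unset Printing Implicit Defensive.

Record sgraph := SGraph {
  vertex :> finType;
  edge : rel vertex;
  edge_sym : symmetric edge;
  edge_irr : irreflexive edge
}.

Definition connected (G : sgraph) : bool :=
  [forall u : G, forall v : G, connect (@edge G) u v].

Section Distance.
Variable G : sgraph.

(* There is a path (no repeated vertex) with exactly k edges from u to v. *)
Definition has_path (k : nat) (u v : G) : bool :=
  [exists p : k.-tuple G,
     [&& path (@edge G) u p, last u p == v & uniq (u :: p)]].

(* A path has fewer than #|G| edges, so the search range is exhaustive; the
   value is #|G| when v is unreachable from u. *)
Definition dist (u v : G) : nat :=
  find (fun k => has_path k u v) (iota 0 #|G|).

(* Ordering the vertices by enum_rank selects each unordered pair {u, v} with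
   u != v exactly once. *)
Definition wiener : nat :=
  \sum_(u : G) \sum_(v : G | enum_rank u < enum_rank v) dist u v.

End Distance.

Section DeleteVertex.
Variables (G : sgraph) (v : G).

Definition del_edge : rel {x : G | x != v} :=
  [rel x y | edge (val x) (val y)].

Fact del_edge_sym : symmetric del_edge.
Proof. by move=> x y; exact: edge_sym. Qed.

Fact del_edge_irr : irreflexive del_edge.
Proof. by move=> x; exact: edge_irr. Qed.

Definition del_vertex : sgraph := SGraph del_edge_sym del_edge_irr.

Definition cut_vertex : bool := ~~ connected del_vertex.

End DeleteVertex.

Definition cut_vertices (G : sgraph) : {set G} := [set v | cut_vertex v].

(* The class of connected graphs with n vertices and exactly s cut vertices. *)
Definition conn_cut (n s : nat) (G : sgraph) : Prop :=
  [/\ connected G, #|G| = n & #|cut_vertices G| = s].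

Section CliquePaths.
Variables (m : nat) (l : 'I_m -> nat).

(* The vertex (i, k) is the k-th vertex of the path P_(l i); its end vertex
   (i, 0) is identified with the i-th vertex of the complete graph K_m. *)
Definition cp_vertex : finType := {i : 'I_m & 'I_(l i)}.

Definition cp_pos (x : cp_vertex) : nat := nat_of_ord (tagged x).

Definition cp_edge : rel cp_vertex :=
  [rel x y | if tag x == tag y
             then ((cp_pos x).+1 == cp_pos y) || ((cp_pos y).+1 == cp_pos x)
             else (cp_pos x == 0) && (cp_pos y == 0)].

Fact cp_edge_sym : symmetric cp_edge.
Proof. by move=> x y; rewrite /cp_edge /= eq_sym orbC andbC. Qed.

Fact cp_edge_irr : irreflexive cp_edge.
Proof. by move=> x; rewrite /cp_edge /= eqxx orbb eqn_leq ltnn. Qed.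

Definition clique_paths : sgraph := SGraph cp_edge_sym cp_edge_irr.

End CliquePaths.

(* Main.v *)
(** Distinct vertices u, v satisfy d(u, v) >= 1 + #{cut vertices separating u
    from v}.  A cut vertex c whose smallest side has a_c vertices separates at
    least a_c (n - 1 - a_c) pairs, so with a_x = 0 at the non-cut vertices
      W(G) >= 'C(n, 2) + sum_x a_x (n - 1 - a_x),
    and equality holds for cliques with paths attached, where a_x is the number
    of vertices beyond x on its path.
    Two smallest sides of equal size are disjoint (otherwise one of the cut
    vertices would have a smaller side, or G would be disconnected), and each
    contains a non-cut vertex.  Hence no value is taken more than m = n - s
    times by a.  As j (n - 1 - j) increases for j <= (n - 1)/2, the sum is
    smallest when each of the values 0, 1, 2, ... in turn is taken exactly m
    times until the n vertices are exhausted, which is what happens for paths of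
    balanced lengths. *)

Require Import Defs.
From mathcomp Require Import all_boot.
From mathcomp Require Import ssrint.
From mathcomp Require Import zify.

Set Implicit Arguments.
Unset Strict Implicit.
Unset Printing Implicit Defensive.

Import IntDist.

(** * Distances and walks *)

Section Distance.
Variable G : sgraph.

Lemma dist_le_size (u : G) (p : seq G) :
  path (@edge G) u p -> dist u (last u p) <= size p.
Proof.
case/shortenP=> p' pP uP sub_p.
have le_p : size p' <= size p.
  by apply: uniq_leq_size sub_p; case/andP: uP.
apply: leq_trans le_p.
have lt_p : size p' < #|G| by have := max_card (mem (u :: p')); rewrite (card_uniqP uP).
rewrite leqNgt; apply/negP => /(before_find 0).
rewrite nth_iota // add0n => /negbT/negP; apply.
by apply/existsP; exists (in_tuple p'); rewrite pP uP eqxx.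
Qed.

Lemma shortest_path (u v : G) : connected G ->
  exists p, [/\ path (@edge G) u p, last u p = v & size p = dist u v].
Proof.
move=> /forallP/(_ u)/forallP/(_ v)/connectP[q /shortenP[p pP uP _] ->].
have lt_p : size p < #|G| by have := max_card (mem (u :: p)); rewrite (card_uniqP uP).
have hasP : has (fun k => has_path k u (last u p)) (iota 0 #|G|).
  apply/hasP; exists (size p); first by rewrite mem_iota.
  by apply/existsP; exists (in_tuple p); rewrite pP uP eqxx.
have := nth_find 0 hasP; move: (hasP); rewrite has_find size_iota => ltd.
rewrite nth_iota // add0n => /existsP[r /and3P[rP /eqP rl _]].
by exists r; rewrite size_tuple.
Qed.

(** Following edges that decrease [d] gives a walk to [v] of length at most [d u v]. This bounds
    distances from above and proves connectedness at once. *)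
Lemma dist_le_descent (d : G -> G -> nat) :
  (forall u v, u != v -> exists2 w, edge u w & d w v < d u v) ->
  forall u v, connect (@edge G) u v /\ dist u v <= d u v.
Proof.
move=> step u v.
suff [p [pP <- le_p]] : exists p, [/\ path (@edge G) u p, last u p = v & size p <= d u v].
  by split; [apply/connectP; exists p | apply: leq_trans (dist_le_size pP) le_p].
have [k] := ubnP (d u v); elim: k u => // k IHk u lt_k.
have [->|/step[w uw lt_w]] := eqVneq u v; first by exists [::].
have [|p [pP pl le_p]] := IHk w; first by lia.
by exists (w :: p); rewrite /= uw pP pl; split=> //; lia.
Qed.

End Distance.

(** * Counting pairs by the vertices that separate them *)

Section Separation.
Variables (V : finType) (A : V -> {set V}).

(** In the applications [A x] is a possibly empty union of components of the graph without [x], so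
    such an [x] separates [u] from [v]. *)
Definition separators (u v : V) : {set V} :=
  [set x | [&& x != u, x != v & (u \in A x) != (v \in A x)]].

Definition sep_dist (u v : V) : nat := (u != v) + #|separators u v|.

Lemma sep_distC u v : sep_dist u v = sep_dist v u.
Proof.
rewrite /sep_dist eq_sym; congr (_ + _); apply: eq_card => x.
by rewrite !inE andbCA [(u \in _) == _]eq_sym.
Qed.

Lemma sep_distxx u : sep_dist u u = 0.
Proof.
by rewrite /sep_dist eqxx; apply: eq_card0 => x; rewrite !inE eqxx !andbF.
Qed.

(** A separated ordered pair has one end in [A x] and the other in the complement of [x |: A x]; the
    two orders give the factor 2. *)
Lemma sum_separated (x : V) : x \notin A x ->
  \sum_u \sum_v (x \in separators u v) = 2 * (#|A x| * (#|V|.-1 - #|A x|)).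
Proof.
move=> xA; pose B := ~: (x |: A x).
have cB : #|B| = #|V|.-1 - #|A x|.
  by rewrite /B cardsCs setCK cardsU1 xA; lia.
transitivity (\sum_u ((u \in A x) * #|B| + (u \in B) * #|A x|)).
  apply: eq_bigr => u _; rewrite -!sum1_card [X in _ * X + _]big_mkcond.
  rewrite [X in _ + _ * X]big_mkcond !big_distrr -big_split /=.
  apply: eq_bigr => v _; rewrite !inE ![x == _]eq_sym.
  have [->|_] := eqVneq u x; have [->|_] := eqVneq v x; rewrite ?(negPf xA) //=.
  - by case: (u \in A x).
  - by case: (u \in A x); case: (v \in A x).
have cardE (S : {set V}) k : \sum_u (u \in S) * k = #|S| * k.
  by rewrite -big_distrl -sum1_card [in RHS]big_mkcond.
by rewrite big_split /= !cardE cB [X in _ + X]mulnC addnn mul2n.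
Qed.

(** Doubling passes to ordered pairs; exchanging the sums then counts, for each [x], the pairs it
    separates. *)
Lemma sum_sep_dist : (forall x, x \notin A x) ->
  2 * (\sum_u \sum_(v | enum_rank u < enum_rank v) sep_dist u v) =
  #|V| * #|V|.-1 + 2 * \sum_x #|A x| * (#|V|.-1 - #|A x|).
Proof.
move=> hA.
have -> : 2 * (\sum_u \sum_(v | enum_rank u < enum_rank v) sep_dist u v) =
          \sum_u \sum_v sep_dist u v.
  rewrite mul2n -addnn.
  rewrite {2}(exchange_big_dep xpredT) //= -big_split /=; apply: eq_bigr => u _.
  rewrite [RHS](bigID (fun v => enum_rank u < enum_rank v)) /=; congr (_ + _).
  rewrite [RHS](bigD1 u) ?ltnn //= sep_distxx add0n.
  apply: eq_big => [v|v _]; last exact: sep_distC.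
  rewrite -leqNgt ltn_neqAle andbC; congr (_ && _).
  by rewrite (inj_eq val_inj) (inj_eq enum_rank_inj).
rewrite /sep_dist.
under eq_bigr => u _ do rewrite big_split /=.
rewrite big_split /=; congr (_ + _).
  rewrite -sum_nat_const; apply: eq_bigr => u _.
  rewrite (bigD1 u) //= eqxx add0n.
  rewrite (eq_bigr (fun=> 1)) => [|v]; last by rewrite eq_sym => ->.
  by rewrite sum1_card cardC1.
transitivity (\sum_u \sum_v \sum_x (x \in separators u v)).
  apply: eq_bigr => u _; apply: eq_bigr => v _.
  by rewrite -sum1_card big_mkcond.
under eq_bigr => u _ do rewrite exchange_big.
rewrite exchange_big big_distrr /=.
by apply: eq_bigr => x _; exact: sum_separated.
Qed.

End Separation.

(** Membership in [A x] cannot change along a path avoiding [x], so a path from [u] to [v] visits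
    every separator, and [v] besides. *)
Lemma sep_dist_le_dist (G : sgraph) (A : G -> {set G}) : connected G ->
  (forall x y z, y \in A x -> edge y z -> z \in x |: A x) ->
  forall u v, sep_dist A u v <= dist u v.
Proof.
move=> cG clA u v.
have [->|uv] := eqVneq u v; first by rewrite sep_distxx.
have [p [pP pl <-]] := shortest_path u v cG.
have vp : v \in p.
  by have := mem_last u p; rewrite pl inE eq_sym (negPf uv).
apply: leq_trans (card_size p).
have -> : sep_dist A u v = #|v |: separators A u v|.
  by rewrite /sep_dist uv cardsU1 inE eqxx andbF.
apply/subset_leq_card/subsetP => x; rewrite !inE => /orP[/eqP->//|].
case/and3P=> xu _; apply: contraR => xp.
have {xp} xp : x \notin u :: p by rewrite inE (negPf xu).
rewrite -pl; apply/eqP; elim: p u {uv pl vp xu} pP xp => //= w p IHp u.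
case/andP=> uw pP; rewrite inE negb_or => /andP[xu xp].
rewrite -(IHp w pP xp).
have xw : w != x by apply: contraNneq xp => ->; rewrite inE eqxx.
apply/idP/idP => [/clA/(_ uw)|/clA-/(_ u)]; first by rewrite !inE (negPf xw).
by rewrite edge_sym => /(_ uw); rewrite !inE eq_sym (negPf xu).
Qed.

(** * Sides of cut vertices in a connected graph *)

Section Sides.
Variable G : sgraph.
Hypothesis cG : connected G.
Implicit Types (c : G) (S : {set G}).

(* A union of components of G - c, neither empty nor all of G - c. *)
Definition side c S : bool :=
  [&& S != set0, c \notin S, c |: S != setT &
      [forall x in S, forall y, edge x y ==> (y \in c |: S)]].

Lemma sideP c S :
  reflect [/\ S != set0, c \notin S, c |: S != setT &
              forall x y, x \in S -> edge x y -> y \in c |: S] (side c S).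
Proof.
apply: (iffP and4P) => -[S0 cS ST H]; split=> //.
  by move=> x y xS; move/forall_inP: H => /(_ x xS)/forallP/(_ y)/implyP.
by apply/forall_inP => x xS; apply/forallP => y; apply/implyP; exact: H.
Qed.

Lemma cut_vertexP c : reflect (exists S, side c S) (cut_vertex c).
Proof.
apply: (iffP idP) => [|[S /sideP[/set0Pn[u uS] cS ST clS]]].
  case/forallPn => u /forallPn[w nuw].
  (* The component of [u] in the graph without [c]; it misses [w]. *)
  pose S := val @: [set y : del_vertex c | connect (@edge (del_vertex c)) u y].
  exists S; apply/sideP; split.
  - by apply/set0Pn; exists (val u); apply: imset_f; rewrite inE connect0.
  - by apply/imsetP => -[[y yc] _ /= cy]; rewrite cy eqxx in yc.
  - apply: contraNneq nuw => ST.
    have : val w \in c |: S by rewrite ST inE.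
    rewrite !inE (negPf (valP w)) /= => /imsetP[y].
    by rewrite inE => uy /val_inj->.
  - move=> _ y /imsetP[x + ->]; rewrite inE => ux xy; rewrite inE in_set1.
    have [//|yc] /= := eqVneq y c.
    apply/imsetP; exists (Sub y yc); last by rewrite SubK.
    by rewrite inE (connect_trans ux) // connect1 //= /del_edge /= SubK.
have [w] : exists w, w \notin c |: S.
  by apply/existsP; rewrite -negb_forall; apply: contraNN ST => /forallP H;
     apply/eqP/setP => x; rewrite H inE.
rewrite !inE negb_or => /andP[wc wS].
have uc : u != c by apply: contraNneq cS => <-.
apply/negP => /forallP/(_ (Sub u uc))/forallP/(_ (Sub w wc))/connectP[p].
move=> pP /(congr1 val); rewrite SubK => wl.
case/negP: wS; rewrite {}wl.
have : val (Sub u uc : {x : G | x != c}) \in S by rewrite SubK.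
elim: p (Sub u uc : {x : G | x != c}) pP => //= y p IHp x /andP[xy pP] xS.
apply: IHp pP _; have := clS _ _ xS xy.
by rewrite !inE (negPf (valP y)).
Qed.

Lemma sideC c S : side c S -> side c (~: (c |: S)).
Proof.
case/sideP=> S0 cS ST clS; apply/sideP; split.
- by apply: contra ST => /eqP H; rewrite -[_ |: _]setCK H setC0.
- by rewrite !inE eqxx.
- case/set0Pn: S0 => x xS; apply/eqP => /setP/(_ x).
  by rewrite !inE xS orbT orbF; apply/negP; apply: contraNneq cS => <-.
- move=> x y; rewrite !inE negb_or => /andP[xc xS] xy.
  have [//|yc] /= := eqVneq y c.
  rewrite edge_sym in xy; apply: contra xS => yS.
  by have := clS _ _ yS xy; rewrite !inE (negPf xc).
Qed.

Lemma closed_full S : S != set0 ->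
  (forall x y, x \in S -> edge x y -> y \in S) -> S = setT.
Proof.
case/set0Pn=> u uS clS; apply/setP => w; rewrite inE.
have /forallP/(_ u)/forallP/(_ w)/connectP[p] := cG.
elim: p u uS => [|y p IHp] /= u uS; first by move=> _ ->.
by case/andP=> uy; apply: IHp; exact: clS uy.
Qed.

(* Of the two sides of c', the one avoiding c meets S in a side of c'. *)
Lemma side_descent c S c' : side c S -> c' \in S -> cut_vertex c' ->
  exists2 S', side c' S' & S' \proper S.
Proof.
move=> /sideP[_ cS _ clS] c'S /cut_vertexP[T0 sT0].
have cc' : c != c' by apply: contraNneq cS => ->.
have [T /sideP[T_n0 c'T TT clT] cT] : exists2 T, side c' T & c \notin T.
  have [cT0|] := boolP (c \in T0); last by exists T0.
  by exists (~: (c' |: T0)); [exact: sideC | rewrite !inE cT0 orbT].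
exists (T :&: S).
  apply/sideP; split.
  (* If [T] missed [S], it would be closed: an edge leaving [T] ends at [c'] in [S], whose
     neighbours lie in [c |: S], which is disjoint from [T]. *)
  - apply/negP => /eqP/setP TS0.
    have TS x : x \in T -> x \notin S by move=> xT; have := TS0 x; rewrite !inE xT => /= ->.
    suff TE : T = setT by rewrite TE inE in c'T.
    apply: closed_full => // x y xT xy; have := clT x y xT xy.
    rewrite !inE => /orP[/eqP yc'|//].
    have := clS y x; rewrite yc' edge_sym -yc' => /(_ _ xy); rewrite yc' => /(_ c'S).
    by rewrite !inE (negPf (TS _ xT)) orbF => /eqP xc; rewrite -xc xT in cT.
  - by rewrite inE (negPf c'T).
  - by apply/eqP => /setP/(_ c); rewrite !inE (negPf cT) orbF (negPf cc').
  - move=> x y; rewrite inE => /andP[xT xS] xy.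
    have := clT _ _ xT xy; have := clS _ _ xS xy; rewrite !inE.
    have [->|_ /= ->] := eqVneq y c; first by rewrite (negPf cT) (negPf cc').
    by rewrite andbT.
rewrite properE subsetIr; apply/subsetPn; exists c' => //.
by rewrite inE (negPf c'T).
Qed.

(** By descent: a cut vertex in [S] has a strictly smaller side inside [S]. *)
Lemma side_noncut c S : side c S -> exists2 x, x \in S & ~~ cut_vertex x.
Proof.
have [k] := ubnP #|S|; elim: k c S => // k IHk c S ltk sS.
have /sideP[/set0Pn[x xS] _ _ _] := sS.
have [cx|] := boolP (cut_vertex x); last by exists x.
have [S' sS' pS] := side_descent sS xS cx.
have [|y yS' ny] := IHk x S' _ sS'; first by have := proper_card pS; lia.
by exists y => //; exact: (subsetP (proper_sub pS)).
Qed.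

(* A smallest side of c; empty when c is not a cut vertex. *)
Definition min_side c : {set G} :=
  if [pick S | side c S] is Some S0 then [arg min_(S < S0 | side c S) #|S|]
  else set0.

Lemma min_side_noncut c : ~~ cut_vertex c -> min_side c = set0.
Proof.
rewrite /min_side; case: pickP => // S sS /negP[].
by apply/cut_vertexP; exists S.
Qed.

Lemma min_sideP c : cut_vertex c ->
  side c (min_side c) /\ forall S, side c S -> #|min_side c| <= #|S|.
Proof.
case/cut_vertexP=> S sS; rewrite /min_side; case: pickP => [S0 sS0|/(_ S)].
  by case: arg_minnP.
by rewrite sS.
Qed.

Lemma notin_min_side c : c \notin min_side c.
Proof.
have [/min_sideP[/sideP[]//]|/min_side_noncut->] := boolP (cut_vertex c).
by rewrite inE.
Qed.

Lemma min_side_closed c x y :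
  x \in min_side c -> edge x y -> y \in c |: min_side c.
Proof.
have [/min_sideP[/sideP[_ _ _ H] _]|/min_side_noncut->] := boolP (cut_vertex c).
  exact: H.
by rewrite inE.
Qed.

(** The complementary side is at least as large, and the two sides together with [c] partition the
    vertices. *)
Lemma card_min_side_half c : 2 * #|min_side c| <= #|G|.-1.
Proof.
have [/min_sideP[sS /(_ _ (sideC sS))]|/min_side_noncut->] := boolP (cut_vertex c).
  have /sideP[_ cS _ _] := sS.
  by rewrite [X in _ <= X]cardsCs setCK cardsU1 cS; lia.
by rewrite cards0.
Qed.

Lemma min_side_avoids c c' : cut_vertex c -> cut_vertex c' ->
  #|min_side c| = #|min_side c'| -> c' \notin min_side c.
Proof.
move=> /min_sideP[sS _] cc' eq_card; apply/negP => c'S.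
have [S' sS' /proper_card] := side_descent sS c'S cc'.
by have [_ /(_ _ sS')] := min_sideP cc'; lia.
Qed.

(** If [c != c'], neither lies in the other's smallest side, so no edge leaves the intersection of
    the sides. By connectedness it is the whole graph, yet it misses [c]. *)
Lemma min_side_inj c c' x : x \in min_side c -> x \in min_side c' ->
  #|min_side c| = #|min_side c'| -> c = c'.
Proof.
move=> xc xc' eq_card; apply/eqP/negPn/negP => cc'.
have cut_mem d : x \in min_side d -> cut_vertex d.
  by move=> xd; apply: contraLR xd => /min_side_noncut->; rewrite inE.
have [kc kc'] := (cut_mem _ xc, cut_mem _ xc').
have c'S := min_side_avoids kc kc' eq_card.
have cS' := min_side_avoids kc' kc (esym eq_card).
suff /setP/(_ c) : min_side c :&: min_side c' = setT.
  by rewrite !inE (negPf cS') andbF.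
apply: closed_full => [|y z]; first by apply/set0Pn; exists x; rewrite inE xc.
rewrite inE => /andP[yc yc'] yz.
have := min_side_closed yc yz; have := min_side_closed yc' yz; rewrite !inE.
have [->|_] := eqVneq z c; first by rewrite (negPf cS') (negPf cc').
by have [->|_ /= -> ->] := eqVneq z c'; first by rewrite (negPf c'S).
Qed.

Lemma card_min_side_fiber t :
  #|[set c | #|min_side c| == t]| <= #|~: cut_vertices G|.
Proof.
have [->|t_gt0] := posnP t.
  apply/subset_leq_card/subsetP => c; rewrite !inE cards_eq0.
  by apply: contraL => /min_sideP[/sideP[]].
(* A non-cut vertex of the smallest side; on the fibre of a positive [t] the default is never
   reached, and disjoint sides make [g] injective. *)
pose g c := odflt c [pick x in min_side c | ~~ cut_vertex x].
have gP c : #|min_side c| = t -> g c \in min_side c /\ ~~ cut_vertex (g c).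
  move=> ct; rewrite /g; case: pickP => [x /andP[]//|noncut].
  have [/min_sideP[/side_noncut[x xS nx] _]|/min_side_noncut S0] := boolP (cut_vertex c).
    by have := noncut x; rewrite xS nx.
  by rewrite -ct S0 cards0 in t_gt0.
rewrite -(card_in_imset (f := g)).
  apply/subset_leq_card/subsetP => _ /imsetP[c + ->].
  by rewrite !inE => /eqP/gP[].
move=> c c'; rewrite !inE => /eqP ct /eqP ct' eq_g.
apply: (min_side_inj (x := g c)); rewrite ?ct ?ct' //; first by case: (gP c ct).
by rewrite eq_g; case: (gP c' ct').
Qed.

End Sides.

(** * Minimising a sum under bounded multiplicities *)

Lemma mul_subn_mono N i j : i <= j -> i + j <= N -> i * (N - i) <= j * (N - j).
(* The difference of the two sides is [(j - i) * (N - i - j)]. *)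
Proof. nia. Qed.

Lemma sum_fibers (T : finType) (g : nat -> nat) (f : T -> nat) (q : nat) :
  (forall j, q <= j -> g j = 0) ->
  \sum_x g (f x) = \sum_(j < q) #|[set x | f x == j]| * g j.
Proof.
move=> g0.
transitivity (\sum_x \sum_(j < q) (f x == j) * g j).
  apply: eq_bigr => x _; have [lt_q|/g0 gx0] := ltnP (f x) q.
    rewrite (bigD1 (Ordinal lt_q)) //= eqxx mul1n big1 ?addn0 // => j.
    by rewrite -val_eqE /= eq_sym => /negPf->.
  by rewrite gx0 big1 // => j _; have [<-|] := eqVneq (f x) j; rewrite ?gx0.
rewrite exchange_big; apply: eq_bigr => j _ /=.
by rewrite -big_distrl /= -sum1dep_card [in RHS]big_mkcond.
Qed.

(* Both sums are compared after subtracting every term from the value h at the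
   top level q: only the levels below q then contribute. *)
Lemma greedy_sum_le (T T' : finType) (a : T -> nat) (b : T' -> nat)
    (N m q : nat) :
  #|T| = #|T'| -> 0 < q -> 2 * q <= N.+1 ->
  (forall x, 2 * a x <= N) -> (forall t, #|[set x | a x == t]| <= m) ->
  (forall y, b y <= q) -> (forall t, t < q -> #|[set y | b y == t]| = m) ->
  \sum_y b y * (N - b y) <= \sum_x a x * (N - a x).
Proof.
move=> eqT q_gt0 qN aN a_fib b_q b_fib.
pose f j := j * (N - j); pose h := f q.
(* For [j < q], [j + q <= 2 * q - 1 <= N]. *)
have low j : j <= q -> f j <= h.
  by rewrite leq_eqVlt => /orP[/eqP->//|jq]; apply: mul_subn_mono; lia.
have high j : q <= j -> 2 * j <= N -> h <= f j by move=> *; apply: mul_subn_mono; lia.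
pose g j := if j < q then h - f j else 0.
have g0 j : q <= j -> g j = 0 by rewrite /g ltnNge => ->.
(* Only an inequality, since [a] may exceed [q], where [f] is at least [h]; for [b], bounded by [q],
   equality holds. *)
have ub : #|T| * h <= \sum_x f (a x) + \sum_x g (a x).
  rewrite -big_split -sum_nat_const /=; apply: leq_sum => x _; rewrite /g.
  by case: ltnP => [|qa]; [lia | have := high _ qa (aN x); lia].
have lb : \sum_y f (b y) + \sum_y g (b y) = #|T'| * h.
  rewrite -big_split -sum_nat_const /=; apply: eq_bigr => y _; rewrite /g.
  have := low _ (b_q y); case: ltnP => [|qb]; first lia.
  have -> : b y = q by apply/eqP; rewrite eqn_leq b_q.
  by rewrite addn0.
have le_g : \sum_x g (a x) <= \sum_y g (b y).
  rewrite !(sum_fibers _ g0) //; apply: leq_sum => j _.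
  by rewrite b_fib ?ltn_ord // leq_mul2r a_fib orbT.
change (\sum_y f (b y) <= \sum_x f (a x)); rewrite eqT in ub; lia.
Qed.

(** * Distances and cut vertices in a clique with attached paths *)

Section CliquePaths.
Variables (m : nat) (l : 'I_m -> nat).
Notation V := (cp_vertex l).
Notation K := (clique_paths l).
Implicit Types u v w x : V.

Lemma cp_eqE u v : (u == v) = (tag u == tag v) && (cp_pos u == cp_pos v).
Proof.
case: u v => i a [j b]; rewrite /cp_pos /=.
have [eq_ij|ne_ij] := eqVneq i j.
  by case: j / eq_ij b => b; rewrite eq_Tagged.
by apply/negP => /eqP/(congr1 (@tag _ _)) /= /eqP; rewrite (negPf ne_ij).
Qed.

Lemma cp_vertexP (i : 'I_m) k : k < l i -> exists2 v : V, tag v = i & cp_pos v = k.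
Proof. by move=> lt_k; exists (existT (fun i => 'I_(l i)) i (Ordinal lt_k)). Qed.

Lemma cp_pos_lt v : cp_pos v < l (tag v).
Proof. by case: v => i a; exact: ltn_ord. Qed.

Lemma sum_cp (F : 'I_m -> nat -> nat) :
  \sum_(v : V) F (tag v) (cp_pos v) = \sum_(i < m) \sum_(k < l i) F i k.
Proof. by rewrite (sig_big_dep _ _ (fun i (k : 'I_(l i)) => F i k)). Qed.

Lemma card_cp_vertex : #|{: V}| = \sum_(i < m) l i.
Proof.
by rewrite card_tagged sumnE big_map big_enum; apply: eq_bigr => i _; rewrite card_ord.
Qed.

Definition above x : {set V} := [set y : V | (tag y == tag x) && (cp_pos x < cp_pos y)].

Definition height x : nat := l (tag x) - (cp_pos x).+1.

Lemma card_above x : #|above x| = height x.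
Proof.
rewrite -sum1dep_card big_mkcond /=.
rewrite (sum_cp (fun i k => if (i == tag x) && (cp_pos x < k) then 1 else 0)).
rewrite (bigD1 (tag x)) //= [X in _ + X]big1 ?addn0 => [|i /negPf ne_i].
  2: by rewrite big1 // => k _; rewrite ne_i.
under eq_bigr => k _ do rewrite eqxx /=.
rewrite /height -(big_mkord xpredT (fun k => if cp_pos x < k then 1 else 0)).
rewrite (big_cat_nat (n := (cp_pos x).+1)) //=; last exact: cp_pos_lt.
rewrite big_nat_cond big1 => [|k]; last by case: ltnP => //; lia.
rewrite add0n big_nat_cond (eq_bigr (fun=> 1)) => [|k]; last by case: ltnP => //; lia.
by rewrite -big_nat_cond sum_nat_const_nat muln1.
Qed.

(** Each path contributes one vertex, at position [l i - t.+1]. *)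
Lemma card_height_fiber t : (forall i, t < l i) -> #|[set x | height x == t]| = m.
Proof.
move=> tl; rewrite -sum1dep_card big_mkcond /=.
rewrite (sum_cp (fun i k => if l i - k.+1 == t then 1 else 0)).
transitivity (\sum_(i < m) 1); last by rewrite sum1_card card_ord.
apply: eq_bigr => i _; have lt_k : l i - t.+1 < l i by have := tl i; lia.
rewrite (bigD1 (Ordinal lt_k)) //= big1 => [|k]; have := tl i.
  by case: eqP => //; lia.
rewrite -val_eqE /= => tli ne_k; have := ltn_ord k.
by case: eqP => //; lia.
Qed.

Lemma cp_step u v : u != v ->
  exists2 w, edge (u : K) w &
    (w == v) || (w \in separators above u v) &&
                (separators above w v \subset separators above u v).
Proof.
have [lu lv] := (cp_pos_lt u, cp_pos_lt v).
rewrite cp_eqE => ne.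
(* [w] is the next vertex towards [v]: along the common path, down towards the clique, or across it
   to the foot of the path of [v]. *)
have [w uw wP] : exists2 w, edge (u : K) w &
   if tag u == tag v then
     (tag w == tag u) &&
     (cp_pos w == if cp_pos u < cp_pos v then (cp_pos u).+1 else (cp_pos u).-1)
   else if 0 < cp_pos u then (tag w == tag u) && (cp_pos w == (cp_pos u).-1)
   else (tag w == tag v) && (cp_pos w == 0).
  move: ne; have [tuv|tuv] /= := eqVneq (tag u) (tag v) => ne.
    have [lt_uv|le_vu] := ltnP.
      have [|w tw pw] := @cp_vertexP (tag u) (cp_pos u).+1; first by rewrite tuv; lia.
      by exists w; rewrite /= /cp_edge /= tw pw !eqxx.
    have [|w tw pw] := @cp_vertexP (tag u) (cp_pos u).-1; first by lia.
    by exists w; rewrite /= /cp_edge /= tw pw !eqxx //; apply/orP; right; lia.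
  have [gt0|] := ltnP.
    have [|w tw pw] := @cp_vertexP (tag u) (cp_pos u).-1; first by lia.
    by exists w; rewrite /= /cp_edge /= tw pw !eqxx //; apply/orP; right; lia.
  have [|w tw pw] := @cp_vertexP (tag v) 0; first by lia.
  by exists w; rewrite /= /cp_edge /= tw pw ?eqxx // (negPf tuv); lia.
exists w => //; rewrite cp_eqE inE /above !inE !cp_eqE.
move: ne wP; rewrite -!val_eqE /=; case: ifP => tuv ne wP.
all: apply/orP; case E: (_ && _); [by left|right].
all: apply/andP; split; first by move: E wP; do ?case: ifP; lia.
all: apply/subsetP => x; rewrite !inE !cp_eqE -!val_eqE /=.
all: by move: E wP; do ?case: ifP; lia.
Qed.

(** Once reached, [w] is no longer a separator, so [sep_dist above] is a potential for
    [dist_le_descent]. *)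
Lemma cp_descent u v : u != v ->
  exists w, [/\ edge (u : K) w, sep_dist above w v < sep_dist above u v &
                (w == v) || (w \in separators above u v)].
Proof.
move=> uv; have [w uw wP] := cp_step uv; exists w; split=> //.
  have [->|wv] := eqVneq w v; first by rewrite sep_distxx /sep_dist uv.
  rewrite /sep_dist uv wv ltn_add2l; apply: proper_card.
  move: wP; rewrite (negPf wv) /= => /andP[w_sep sub].
  by rewrite properE sub; apply/subsetPn; exists w; rewrite // inE eqxx.
by case/orP: wP => [->|/andP[-> _]]; rewrite ?orbT.
Qed.

Lemma cp_connect_dist (u v : K) :
  connect (@edge K) u v /\ dist u v <= sep_dist above u v.
Proof.
apply: dist_le_descent => {}u {}v /cp_descent[w [uw lt_w _]].
by exists w.
Qed.

Lemma cp_connected : connected K.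
Proof. by apply/forallP => u; apply/forallP => v; case: (cp_connect_dist u v). Qed.

(** A vertex of height 0 separates no pair, so the descent from inside a supposed side to a vertex
    [v] outside never meets [x] and cannot leave the side. At positive height [above x] is a side, a
    second path supplying a vertex outside it. *)
Lemma cp_cut_vertex (x : K) : 1 < m -> (forall i, 0 < l i) ->
  cut_vertex x = (0 < height x).
Proof.
move=> m_gt1 l_gt0; apply/cut_vertexP/idP => [[S /sideP[S0 xS ST clS]]|hx].
  rewrite lt0n; apply/negP => /eqP hx0.
  have noabove u v : x \notin separators above u v.
    have /eqP := card_above x; rewrite hx0 cards_eq0 => /eqP ax0.
    by rewrite inE ax0 !inE eqxx !andbF.
  have [u uS] := set0Pn _ S0.
  have /set0Pn[v] : ~: (x |: S) != set0.
    by apply: contra ST => /eqP H; rewrite -[_ |: _]setCK H setC0.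
  rewrite !inE negb_or => /andP[vx vS].
  have [k] := ubnP (sep_dist above u v); elim: k u uS => // k IHk u uS lt_k.
  have uv : u != v by apply: contraNneq vS => <-.
  have [w [uw lt_w wP]] := cp_descent uv.
  have wx : w != x.
    apply/eqP => wx; move: wP; rewrite wx (negPf (noabove _ _)) orbF.
    by rewrite eq_sym (negPf vx).
  have wS : w \in S by have := clS _ _ uS uw; rewrite !inE (negPf wx).
  by apply: (IHk w wS); lia.
exists (above x); apply/sideP; split.
- by rewrite -card_gt0 card_above.
- by rewrite inE ltnn andbF.
- have [j ne_j] : exists j : 'I_m, j != tag x.
    have : 0 < #|predC1 (tag x)| by rewrite cardC1 card_ord; lia.
    by case/card_gt0P => j; exists j.
  have [y ty _] := cp_vertexP (l_gt0 j).
  apply/eqP => /setP/(_ y); rewrite !inE ty (negPf ne_j) orbF.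
  by apply/negP; apply: contraNneq ne_j => <-; rewrite ty.
- move=> u v; rewrite !inE cp_eqE -!val_eqE /= /cp_edge /= -!val_eqE /=.
  by case: ifP; lia.
Qed.

End CliquePaths.

Theorem theorem1p4 (n s : nat) (l : 'I_(n - s) -> nat)
    (hs : s + 3 <= n)
    (l_gt0 : forall i : 'I_(n - s), 0 < l i)
    (l_sum : \sum_(i < n - s) l i = n)
    (l_bal : forall i j : 'I_(n - s), `|l i - l j| <= 1) :
  conn_cut n s (clique_paths l) /\
  (forall G : sgraph, conn_cut n s G -> wiener (clique_paths l) <= wiener G).
Proof.
have card_K : #|clique_paths l| = n by rewrite card_cp_vertex.
split=> [|G [cG card_G card_cut]].
  split=> //; first exact: cp_connected.
  rewrite cardsCs card_K.
  (* The non-cut vertices are the far ends of the paths, one on each. *)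
  have -> : ~: cut_vertices (clique_paths l) = [set x | height x == 0].
    by apply/setP => x; rewrite !inE cp_cut_vertex ?lt0n ?negbK //; lia.
  by rewrite card_height_fiber //; lia.
have [i0 _ i0_min] : exists2 i0, true & forall i, l i0 <= l i.
  have lt0 : 0 < n - s by lia.
  by exists [arg min_(i < Ordinal lt0) l i] => // i; case: arg_minnP => // j _; apply.
(* Balance makes every length [q] or [q.+1]: heights are at most [q], and each height below [q]
   occurs once per path. *)
pose q := l i0.
(* At least three paths have [q] or more vertices each; this gives the bound on [2 * q] in
   [greedy_sum_le]. *)
have q3 : 3 * q <= n.
  rewrite -[leqRHS]l_sum; apply: (@leq_trans ((n - s) * q)).
    by rewrite leq_mul2r; apply/orP; right; lia.
  by rewrite -[n - s in leqLHS]card_ord -sum_nat_const; apply: leq_sum.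
have q_gt0 : 0 < q by exact: l_gt0.
have wK : wiener (clique_paths l) <=
    \sum_(u : clique_paths l) \sum_(v | enum_rank u < enum_rank v) sep_dist (@above _ l) u v.
  by apply: leq_sum => u _; apply: leq_sum => v _; case: (cp_connect_dist u v).
have wG : \sum_(u : G) \sum_(v | enum_rank u < enum_rank v) sep_dist (@min_side G) u v
    <= wiener G.
  apply: leq_sum => u _; apply: leq_sum => v _; apply: sep_dist_le_dist => //.
  by move=> c x y; exact: min_side_closed.
apply: leq_trans wK (leq_trans _ wG).
(* After doubling, both sides share the term [n * n.-1], and only the sums over side sizes
   remain. *)
rewrite -(leq_pmul2l (isT : 0 < 2)) !sum_sep_dist; last 2 first.
- by move=> x; rewrite inE ltnn andbF.
- exact: notin_min_side.
rewrite card_K card_G leq_add2l leq_pmul2l //.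
under eq_bigr => x _ do rewrite card_above.
apply: (@greedy_sum_le _ _ _ _ n.-1 (n - s) q) => //.
- by rewrite card_G card_K.
- by lia.
- by move=> x; rewrite -card_G; exact: card_min_side_half.
- move=> t; rewrite (_ : n - s = #|~: cut_vertices G|); first exact: card_min_side_fiber.
  by rewrite cardsCs setCK card_G card_cut.
- move=> x; have := l_bal (tag x) i0; have := i0_min (tag x); rewrite /height -/q.
  by rewrite distnEl ?i0_min //; lia.
- by move=> t lt_t; apply: card_height_fiber => i; apply: leq_trans (i0_min i).
Qed.
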